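(* ${\sf ITL}^0_{\Diamond\forall}$ is complete for $\mathbb Q$: if $\varphi\in\mathcal L_{\Diamond\forall}$ is valid on every dynamical system of the form $(\mathbb Q,f)$, where $\mathbb Q$ carries its usual topology and $f\colon\mathbb Q\to\mathbb Q$ is continuous, then $\varphi\in{\sf ITL}^0_{\Diamond\forall}$.
   Context: Syntax: fix a countably infinite set $\mathbb P$ of propositional variables. $\mathcal L_{\Diamond\forall}$ is given by $\varphi ::= \bot \mid p \mid \varphi\wedge\varphi \mid \varphi\vee\varphi \mid \varphi\to\varphi \mid \circ\varphi \mid \Diamond\varphi \mid \forall\varphi$; $\neg\varphi:=\varphi\to\bot$, $\varphi\leftrightarrow\psi:=(\varphi\to\psi)\wedge(\psi\to\varphi)$. Semantics: a dynamical system is $(X,\mathcal T,f)$ with $f$ continuous. A valuation assigns to each formula an open set with $[\![\bot]\!]=\varnothing$, $[\![\varphi\wedge\psi]\!]=[\![\varphi]\!]\cap[\![\psi]\!]$, $[\![\varphi\vee\psi]\!]=[\![\varphi]\!]\cup[\![\psi]\!]$, $[\![\varphi\to\psi]\!]=\big((X\setminus[\![\varphi]\!])\cup[\![\psi]\!]\big)^\circ$, $[\![\circ\varphi]\!]=f^{-1}[\![\varphi]\!]$, $[\![\Diamond\varphi]\!]=\bigcup_{n<\omega}f^{-n}[\![\varphi]\!]$, $[\![\forall\varphi]\!]=X$ if $[\![\varphi]\!]=X$ and $\varnothing$ otherwise. $\varphi$ is valid on a system if $[\![\varphi]\!]=X$ for every valuation. Logic: ${\sf ITL}^0_{\Diamond\forall}$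 is the least set of $\mathcal L_{\Diamond\forall}$-formulas containing all substitution instances of the axioms of intuitionistic propositional logic and of (N1) $\neg\circ\bot$, (N2) $\circ\varphi\wedge\circ\psi\to\circ(\varphi\wedge\psi)$, (N3) $\circ(\varphi\vee\psi)\to\circ\varphi\vee\circ\psi$, (N4) $\circ(\varphi\to\psi)\to(\circ\varphi\to\circ\psi)$, (E1) $\varphi\vee\circ\Diamond\varphi\to\Diamond\varphi$, (UA1) $\forall\varphi\vee\neg\forall\varphi$, (UA2) $\forall(\varphi\to\psi)\to(\forall\varphi\to\forall\psi)$, (UA3) $\forall(\varphi\vee\forall\psi)\to\forall\varphi\vee\forall\psi$, (UA4) $\forall\varphi\to\varphi$, (UA5) $\forall\varphi\to\forall\forall\varphi$, (UA6) $\forall\varphi\leftrightarrow\circ\forall\varphi$, closed under modus ponens, from $\varphi$ infer $\circ\varphi$, from $\varphi\to\psi$ infer $\Diamond\varphi\to\Diamond\psi$, from $\circ\varphi\to\varphi$ infer $\Diamond\varphi\to\varphi$, and from $\varphi$ infer $\forall\varphi$. *)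

(* Defs.v *)
From mathcomp Require Import all_boot all_order all_algebra.
Set Implicit Arguments. Unset Strict Implicit. Unset Printing Implicit Defensive.
Import Order.TTheory GRing.Theory Num.Theory.
Local Open Scope ring_scope.

Inductive fml : Type :=
| Bot : fml
| Var : nat -> fml
| And : fml -> fml -> fml
| Or  : fml -> fml -> fml
| Imp : fml -> fml -> fml
| Next : fml -> fml
| Dia : fml -> fml
| All : fml -> fml.

Definition Neg (p : fml) : fml := Imp p Bot.
Definition Iff (p q : fml) : fml := And (Imp p q) (Imp q p).

Inductive ITL0 : fml -> Prop :=
| ax_K  p q     : ITL0 (Imp p (Imp q p))
| ax_S  p q r   : ITL0 (Imp (Imp p (Imp q r)) (Imp (Imp p q) (Imp p r)))
| ax_andE1 p q  : ITL0 (Imp (And p q) p)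
| ax_andE2 p q  : ITL0 (Imp (And p q) q)
| ax_andI p q   : ITL0 (Imp p (Imp q (And p q)))
| ax_orI1 p q   : ITL0 (Imp p (Or p q))
| ax_orI2 p q   : ITL0 (Imp q (Or p q))
| ax_orE p q r  : ITL0 (Imp (Imp p r) (Imp (Imp q r) (Imp (Or p q) r)))
| ax_efq p      : ITL0 (Imp Bot p)
| ax_N1         : ITL0 (Neg (Next Bot))
| ax_N2 p q     : ITL0 (Imp (And (Next p) (Next q)) (Next (And p q)))
| ax_N3 p q     : ITL0 (Imp (Next (Or p q)) (Or (Next p) (Next q)))
| ax_N4 p q     : ITL0 (Imp (Next (Imp p q)) (Imp (Next p) (Next q)))
| ax_E1 p       : ITL0 (Imp (Or p (Next (Dia p))) (Dia p))
| ax_UA1 p      : ITL0 (Or (All p) (Neg (All p)))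
| ax_UA2 p q    : ITL0 (Imp (All (Imp p q)) (Imp (All p) (All q)))
| ax_UA3 p q    : ITL0 (Imp (All (Or p (All q))) (Or (All p) (All q)))
| ax_UA4 p      : ITL0 (Imp (All p) p)
| ax_UA5 p      : ITL0 (Imp (All p) (All (All p)))
| ax_UA6 p      : ITL0 (Iff (All p) (Next (All p)))
| r_MP p q      : ITL0 (Imp p q) -> ITL0 p -> ITL0 q
| r_NecNext p   : ITL0 p -> ITL0 (Next p)
| r_DiaMono p q : ITL0 (Imp p q) -> ITL0 (Imp (Dia p) (Dia q))
| r_Ind p       : ITL0 (Imp (Next p) p) -> ITL0 (Imp (Dia p) p)
| r_NecAll p    : ITL0 p -> ITL0 (All p).

Definition Qopen (U : rat -> Prop) : Prop :=
  forall x, U x -> exists e : rat, 0 < e /\ forall y, `|y - x| < e -> U y.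

Definition Qinterior (S : rat -> Prop) : rat -> Prop :=
  fun x => exists U : rat -> Prop, Qopen U /\ U x /\ (forall y, U y -> S y).

Definition Qcontinuous (f : rat -> rat) : Prop :=
  forall U, Qopen U -> Qopen (fun x => U (f x)).

Fixpoint sem (f : rat -> rat) (V : nat -> rat -> Prop) (p : fml) : rat -> Prop :=
  match p with
  | Bot => fun _ => False
  | Var n => V n
  | And p q => fun x => sem f V p x /\ sem f V q x
  | Or p q => fun x => sem f V p x \/ sem f V q x
  | Imp p q => Qinterior (fun x => ~ sem f V p x \/ sem f V q x)
  | Next p => fun x => sem f V p (f x)
  | Dia p => fun x => exists n : nat, sem f V p (iter n f x)
  | All p => fun _ => forall y, sem f V p y
  end.

Definition valid_on_Q (f : rat -> rat) (p : fml) : Prop :=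
  forall V : nat -> rat -> Prop, (forall n, Qopen (V n)) -> forall x, sem f V p x.

(* Main.v *)
Require Import Defs.
From HB Require Import structures.
From mathcomp Require Import all_boot all_order all_algebra.
From mathcomp Require Import boolp lra.
Set Implicit Arguments. Unset Strict Implicit. Unset Printing Implicit Defensive.
Import Order.TTheory GRing.Theory Num.Theory.

(* If [phi] is not derivable, some prime theory omits it.  The formulas which
   that theory holds globally form a logic [L] modulo which every [All p] is
   provable or refutable, so only the fragment without [All] is at stake.

   The prime theories over [L] are collapsed to finitely many points: a point
   records which subformulas of [phi] hold and which formulas of a finite list
   fail, the list being rich enough to contain, for each point [v] above, a
   formula [chi v] that fails exactly below the theories matching [v].  If an
   eventuality [Dia a] of a point [w] were never reachable, the conjunction
   [th] of all [chi v], [v] reachable from [w], would satisfy [Next th -> th]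
   and [a -> th], hence [Dia a -> th -> chi w], contradicting that [w] is
   matched.  The points thus form a finite nondeterministic model in which
   every eventuality can be realised.

   A path through this model is realised on the rationals as follows.  Consider
   finitely supported integer sequences, the entry at [t] being an instruction
   to replace the current path by one that dominates it before time [t].  The
   path finally reached labels the sequence, and passing to tails gives a
   continuous map of sequences.  Near a given sequence the labels are exactly
   those above its own, because late instructions may go anywhere above.  Under
   the lexicographic order these sequences form a countable dense order without
   endpoints whose order topology is that of agreement on initial segments, so
   by Cantor's theorem they are a copy of the rationals. *)

(** * Theories and the logic of a global theory *)

(** Coding formulas as generic trees makes them countable, so that the Lindenbaum construction can
    enumerate them. *)
Fixpoint fml_tree (p : fml) : GenTree.tree nat :=
  match p with
  | Bot => GenTree.Node 0 [::]
  | Var n => GenTree.Leaf n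
  | And p q => GenTree.Node 1 [:: fml_tree p; fml_tree q]
  | Or p q => GenTree.Node 2 [:: fml_tree p; fml_tree q]
  | Imp p q => GenTree.Node 3 [:: fml_tree p; fml_tree q]
  | Next p => GenTree.Node 4 [:: fml_tree p]
  | Dia p => GenTree.Node 5 [:: fml_tree p]
  | All p => GenTree.Node 6 [:: fml_tree p]
  end.

Fixpoint tree_fml (t : GenTree.tree nat) : fml :=
  match t with
  | GenTree.Leaf n => Var n
  | GenTree.Node 1 [:: p; q] => And (tree_fml p) (tree_fml q)
  | GenTree.Node 2 [:: p; q] => Or (tree_fml p) (tree_fml q)
  | GenTree.Node 3 [:: p; q] => Imp (tree_fml p) (tree_fml q)
  | GenTree.Node 4 [:: p] => Next (tree_fml p)
  | GenTree.Node 5 [:: p] => Dia (tree_fml p)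
  | GenTree.Node 6 [:: p] => All (tree_fml p)
  | _ => Bot
  end.

Lemma fml_treeK : cancel fml_tree tree_fml.
Proof. by elim=> //= [p -> q ->|p -> q ->|p -> q ->|p ->|p ->|p ->]. Qed.

HB.instance Definition _ := Countable.copy fml (can_type fml_treeK).

Definition theory (T : fml -> Prop) : Prop :=
  (forall p, ITL0 p -> T p) /\ (forall p q, T (Imp p q) -> T p -> T q).

Definition subth (T U : fml -> Prop) : Prop := forall p, T p -> U p.

Definition adjoin (T : fml -> Prop) (a : fml) : fml -> Prop := fun b => T (Imp a b).

Definition prime_theory (T : fml -> Prop) : Prop :=
  [/\ theory T, ~ T Bot & forall a b, T (Or a b) -> T a \/ T b].

Section Theory.

Variable T : fml -> Prop.
Hypothesis cT : theory T.

Lemma cl_ax p : ITL0 p -> T p. Proof. exact: cT.1. Qed.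
Lemma cl_mp p q : T (Imp p q) -> T p -> T q. Proof. exact: cT.2. Qed.

Lemma cl_ax1 p q : ITL0 (Imp p q) -> T p -> T q.
Proof. by move=> /cl_ax /cl_mp; apply. Qed.

Lemma cl_ax2 p q r : ITL0 (Imp p (Imp q r)) -> T p -> T q -> T r.
Proof. by move=> h /(cl_ax1 h)/cl_mp; apply. Qed.

Lemma sub_adjoin a : subth T (adjoin T a).
Proof. by move=> b; apply: cl_ax1; apply: ax_K. Qed.

Lemma theory_adjoin a : theory (adjoin T a).
Proof.
split=> [p /cl_ax/sub_adjoin//|p q]; exact: cl_ax2 (ax_S _ _ _).
Qed.

Lemma mem_adjoin a : adjoin T a a.
Proof.
apply: (cl_mp (p := Imp a (Imp a a))); last exact/cl_ax/ax_K.
apply: (cl_mp (p := Imp a (Imp (Imp a a) a))); last exact/cl_ax/ax_K.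
exact/cl_ax/ax_S.
Qed.

(** The deduction theorem: [adjoin T a] is itself one of the theories [U]. Formal derivations give
    way to reasoning inside extensions of [T]. *)
Lemma cl_impI a b :
  (forall U, theory U -> subth T U -> U a -> U b) -> T (Imp a b).
Proof.
by move=> h; apply: (h (adjoin T a)) (mem_adjoin a);
  [apply: theory_adjoin|apply: sub_adjoin].
Qed.

Lemma cl_and a b : T (And a b) <-> T a /\ T b.
Proof.
split=> [h|[]]; last exact: cl_ax2 (ax_andI _ _).
by split; [apply: cl_ax1 h; apply: ax_andE1|apply: cl_ax1 h; apply: ax_andE2].
Qed.

Lemma cl_orl a b : T a -> T (Or a b). Proof. exact: cl_ax1 (ax_orI1 _ _). Qed.
Lemma cl_orr a b : T b -> T (Or a b). Proof. exact: cl_ax1 (ax_orI2 _ _). Qed.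

Lemma cl_orE a b c : T (Imp a c) -> T (Imp b c) -> T (Or a b) -> T c.
Proof. by move=> h1 h2; apply: cl_mp; exact: (cl_ax2 (ax_orE _ _ _)) h1 h2. Qed.

Lemma cl_imp_trans a b c : T (Imp a b) -> T (Imp b c) -> T (Imp a c).
Proof.
move=> h1 h2; apply: cl_impI => U cU sU ha.
by apply: (cU.2 b) (cU.2 a _ (sU _ h1) ha); apply: sU.
Qed.

End Theory.

Lemma theory_ITL0 : theory ITL0.
Proof. by split=> // p q; apply: r_MP. Qed.

Section Lindenbaum.

Variables (T : fml -> Prop) (c : fml).
Hypotheses (cT : theory T) (nTc : ~ T c).

Fixpoint lind (n : nat) : fml -> Prop :=
  if n is n'.+1 then
    if unpickle n' is Some a then
      if `[< adjoin (lind n') a c >] then lind n' else adjoin (lind n') a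
    else lind n'
  else T.

Lemma lind_theory n : theory (lind n) /\ ~ lind n c.
Proof.
elim: n => //= n [IH1 IH2]; case: (unpickle n) => // a.
by case: asboolP => // h; split=> //; apply: theory_adjoin.
Qed.

Lemma lind_mono m n : m <= n -> subth (lind m) (lind n).
Proof.
elim: n => [|n IH]; first by rewrite leqn0 => /eqP->.
rewrite leq_eqVlt => /predU1P[->//|]; rewrite ltnS => /IH h p /h {}h /=.
case: (unpickle n) => // a; case: asboolP => // _.
exact: sub_adjoin (lind_theory n).1 _ _ h.
Qed.

Lemma Lindenbaum : exists G, [/\ prime_theory G, subth T G & ~ G c].
Proof.
pose G p := exists n, lind n p.
have cG : theory G.
  split=> [p hp|p q [m hm] [n hn]]; first by exists 0; apply: cT.1.
  exists (maxn m n); apply: (cl_mp (lind_theory _).1 (p := p)).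
    exact: (lind_mono (leq_maxl m n)).
  exact: (lind_mono (leq_maxr m n)).
have nGc : ~ G c by case=> n; apply: (lind_theory n).2.
(* A formula rejected at its stage implies [c] there. Two rejected disjuncts would make their
   disjunction imply [c]; hence primality. *)
have dec a : G a \/ G (Imp a c).
  case: (pselect (adjoin (lind (pickle a)) a c)) => h; first by right; exists (pickle a).
  left; exists (pickle a).+1 => /=; rewrite pickleK; case: asboolP => // _.
  exact: mem_adjoin (lind_theory _).1 _.
exists G; split=> //; last by move=> p hp; exists 0.
split=> // [h|a b h]; first by apply/nGc/(cl_ax1 cG _ h)/ax_efq.
case: (dec a) => ha; first by left.
case: (dec b) => hb; first by right.
by case: nGc; apply: cl_orE ha hb h.
Qed.

End Lindenbaum.

Record logic (L : fml -> Prop) : Prop := Logic {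
  logic_theory : theory L;
  logic_next : forall p, L p -> L (Next p);
  logic_dia : forall p q, L (Imp p q) -> L (Imp (Dia p) (Dia q));
  logic_ind : forall p, L (Imp (Next p) p) -> L (Imp (Dia p) p);
  logic_all : forall p, L p -> L (All p);
  logic_nall : forall p, ~ L p -> L (Neg (All p)) }.

(* Modulo the formulas a prime theory holds globally, [All] becomes a truth
   value; this reduces the universal modality to a choice of logic. *)
Lemma logic_of_prime G : prime_theory G -> logic (fun p => G (All p)).
Proof.
move=> [cG nB pG].
have Gmp p q : G (All (Imp p q)) -> G (All p) -> G (All q).
  exact: cl_ax2 (ax_UA2 _ _).
have Gax p : ITL0 p -> G (All p) by move=> h; apply/(cl_ax cG)/r_NecAll.
have cA : theory (fun p => G (All p)) by split.
(* Since [UA5] gives [All (All p)], derivable consequences of [All p] hold globally as well. *)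
have under p q : ITL0 (Imp (All p) q) -> G (All p) -> G (All q).
  move=> h hp; apply: (Gmp (All p)); first exact: Gax.
  by apply: cl_ax1 hp => //; apply: ax_UA5.
have nextA p : ITL0 (Imp (All p) (Next (All p))).
  by have /(cl_and theory_ITL0)[] := ax_UA6 p.
have cI := theory_ITL0.
have nextI p q : ITL0 (Imp p q) -> ITL0 (Imp (Next p) (Next q)).
  by move=> h; apply: r_MP (ax_N4 _ _) _; apply: r_NecNext.
(* The induction rule survives the assumption [All p], since [All p -> Next (All p)]. *)
have indA p q r : ITL0 (Imp q r) ->
    ITL0 (Imp (All p) (Imp (Next r) r)) -> ITL0 (Imp (All p) (Imp (Dia q) r)).
  move=> hqr h; pose t := Imp (All p) r.
  have qt : ITL0 (Imp q t) by apply: cl_imp_trans hqr _; last apply: ax_K.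
  have tt : ITL0 (Imp (Next t) t).
    apply: (cl_impI cI) => U cU _ hU; apply: (cl_impI cU) => U' cU' sU hp.
    apply: (cl_ax2 cU' h) => //; apply: (cl_mp cU' (p := Next (All p))).
      by apply: (cl_ax1 cU' (ax_N4 _ _)); apply: sU.
    exact: cl_ax1 hp.
  have dt : ITL0 (Imp (Dia q) t).
    by apply: cl_imp_trans (r_DiaMono qt) (r_Ind tt).
  apply: (cl_impI cI) => U cU _ hp; apply: (cl_impI cU) => U' cU' sU hq.
  by apply: (cl_ax2 cU' dt) => //; apply: sU.
split=> //.
- move=> p; apply: under; apply: cl_imp_trans (nextA p) _ => //.
  exact/nextI/ax_UA4.
- move=> p q; apply: under.
  set pq := Imp p q.
  (* The guard [All pq] sits inside [r] because [indA] asks for the base case [p -> r] without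
     assumptions. *)
  pose r := Imp (All pq) (Dia q).
  have pr : ITL0 (Imp p r).
    apply: (cl_impI cI) => U cU _ hp; apply: (cl_impI cU) => U' cU' sU ha.
    apply: (cl_ax1 cU' (ax_E1 _)); apply: cl_orl => //.
    by apply: (cl_mp cU' (cl_ax1 cU' (ax_UA4 _) ha)); apply: sU.
  have h : ITL0 (Imp (All pq) (Imp (Dia p) r)).
    apply: indA => //; apply: (cl_impI cI) => U cU _ hA; apply: (cl_impI cU) => U' cU' sU hr.
    apply: (cl_impI cU') => U2 cU2 sU2 _; apply: (cl_ax1 cU2 (ax_E1 _)); apply: cl_orr => //.
    apply: (cl_mp cU2 (p := Next (All pq))); first by apply: (cl_ax1 cU2 (ax_N4 _ _)); apply: sU2.
    by apply: (cl_ax1 cU2 (nextA _)); apply/sU2/sU.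
  apply: (cl_impI cI) => U cU _ hA; apply: (cl_impI cU) => U' cU' sU hp.
  by apply: (cl_mp cU' (p := All pq)); [apply: (cl_ax2 cU' h)|]; auto.
- move=> p; apply: under; apply: indA; last exact: ax_UA4.
  exact: mem_adjoin.
- by move=> p; apply: cl_ax1 => //; apply: ax_UA5.
(* [UA3] pulls the disjunction of [UA1] out of [All], where primality of [G] can split it. *)
- move=> p np; have /pG[//|] : G (Or (All (Neg (All p))) (All p)).
    apply: (cl_ax1 cG (ax_UA3 _ _)); apply: Gax.
    apply: (cl_orE cI _ _ (ax_UA1 p)); [exact: ax_orI2|exact: ax_orI1].
  by [].
Qed.

(** * The finite quasimodel *)

Fixpoint subformulas (p : fml) : seq fml :=
  p :: match p with
       | And a b | Or a b | Imp a b => subformulas a ++ subformulas b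
       | Next a | Dia a | All a => subformulas a
       | _ => [::]
       end.

Definition subformula_closed (S : seq fml) : Prop :=
  forall p, p \in S ->
  match p with
  | And a b | Or a b | Imp a b => a \in S /\ b \in S
  | Next a | Dia a | All a => a \in S
  | _ => True
  end.

Lemma mem_subformulas p : p \in subformulas p.
Proof. by case: p => *; rewrite mem_head. Qed.

Lemma subformulas_closed p : subformula_closed (subformulas p).
Proof.
have sub1 a s : subformula_closed (subformulas a) ->
    {subset subformulas a <= s} -> forall q, q \in subformulas a ->
    match q with
    | And b c | Or b c | Imp b c => b \in s /\ c \in s
    | Next b | Dia b | All b => b \in s
    | _ => True
    end.
  move=> ca sa q /ca.
  by case: q => [|n|b c|b c|b c|b|b|b] //= => [[/sa ? /sa]|[/sa ? /sa]|[/sa ? /sa]|/sa|/sa|/sa].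
elim: p => [|n|a IHa b IHb|a IHa b IHb|a IHa b IHb|a IHa|a IHa|a IHa] q /=;
  rewrite in_cons => /predU1P[->|] //.
- by rewrite !inE !mem_cat !mem_subformulas !orbT.
- by rewrite mem_cat => /orP[]; apply: sub1 => // x; rewrite inE mem_cat => ->; rewrite !orbT.
- by rewrite !inE !mem_cat !mem_subformulas !orbT.
- by rewrite mem_cat => /orP[]; apply: sub1 => // x; rewrite inE mem_cat => ->; rewrite !orbT.
- by rewrite !inE !mem_cat !mem_subformulas !orbT.
- by rewrite mem_cat => /orP[]; apply: sub1 => // x; rewrite inE mem_cat => ->; rewrite !orbT.
- by rewrite !inE mem_subformulas orbT.
- by apply: sub1 => // x; rewrite inE => ->; rewrite !orbT.
- by rewrite !inE mem_subformulas orbT.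
- by apply: sub1 => // x; rewrite inE => ->; rewrite !orbT.
- by rewrite !inE mem_subformulas orbT.
- by apply: sub1 => // x; rewrite inE => ->; rewrite !orbT.
Qed.

Fixpoint sublists (T : Type) (s : seq T) : seq (seq T) :=
  if s is x :: s' then sublists s' ++ map (cons x) (sublists s') else [:: [::]].

Lemma filter_sublists (T : eqType) (p : pred T) (s : seq T) :
  filter p s \in sublists s.
Proof.
elim: s => //= x s IH; rewrite mem_cat; case: (p x); rewrite ?IH //.
by rewrite map_f ?orbT.
Qed.

Definition bigAnd (A : seq fml) : fml := foldr And (Imp Bot Bot) A.
Definition bigOr (A : seq fml) : fml := foldr Or Bot A.

Lemma cl_bigAnd T A : theory T -> (T (bigAnd A) <-> forall a, a \in A -> T a).
Proof.
move=> cT; elim: A => [|x A IH]; first by split=> // _; apply/(cl_ax cT)/ax_efq.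
rewrite /= (cl_and cT) IH; split=> [[h1 h2] a|h].
  by rewrite in_cons => /predU1P[->|/h2].
by split=> [|a ha]; apply: h; rewrite inE ?eqxx ?ha ?orbT.
Qed.

Lemma prime_or T a b : prime_theory T -> (T (Or a b) <-> T a \/ T b).
Proof.
case=> cT _ pT; split; first exact: pT.
by case; [apply: cl_orl|apply: cl_orr].
Qed.

Lemma prime_bigOr T A : prime_theory T ->
  (T (bigOr A) <-> exists2 a, a \in A & T a).
Proof.
move=> pT; elim: A => [|x A IH]; first by case: pT => _ nB _; split=> // [[]].
rewrite /= (prime_or _ _ pT) IH; split=> [[h|[a aA ha]]|[a]].
- by exists x; rewrite ?mem_head.
- by exists a; rewrite // inE aA orbT.
- by rewrite inE => /predU1P[->|aA ha]; [left|right; exists a].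
Qed.

Fixpoint walk (T : Type) (step : T -> T -> Prop) (n : nat) (w v : T) : Prop :=
  if n is n'.+1 then exists2 u, walk step n' w u & step u v else w = v.

Lemma walkSl (T : Type) (step : T -> T -> Prop) n w v :
  walk step n.+1 w v -> exists2 u, step w u & walk step n u v.
Proof.
elim: n v => [|n IH] v; first by case=> u <- h; exists v.
by case=> u /IH[u' h1 h2] h3; exists u' => //; exists u.
Qed.

(** Steps form a relation, and [qstep_confluent] stands in for continuity. [qsensible] only promises
    that some walk reaches an eventuality. Points are countable so that paths can be coded by
    integers. *)
Record quasimodel (S : seq fml) := Quasimodel {
  qpt : countType;
  qle : qpt -> qpt -> Prop;
  qstep : qpt -> qpt -> Prop;
  qlab : qpt -> fml -> Prop;
  qle_refl : forall w, qle w w;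
  qle_trans : forall w v u, qle w v -> qle v u -> qle w u;
  qlab_mono : forall w v a, a \in S -> qle w v -> qlab w a -> qlab v a;
  qlab_bot : forall w, Bot \in S -> ~ qlab w Bot;
  qlab_and : forall w a b, And a b \in S ->
    qlab w (And a b) <-> qlab w a /\ qlab w b;
  qlab_or : forall w a b, Or a b \in S ->
    qlab w (Or a b) <-> qlab w a \/ qlab w b;
  qlab_imp : forall w a b, Imp a b \in S ->
    qlab w (Imp a b) <-> forall v, qle w v -> qlab v a -> qlab v b;
  qlab_next : forall w v a, Next a \in S -> qstep w v ->
    qlab w (Next a) <-> qlab v a;
  qlab_dia : forall w v a, Dia a \in S -> qstep w v ->
    qlab w (Dia a) <-> qlab w a \/ qlab v (Dia a);
  qlab_all : forall w a, All a \in S ->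
    qlab w (All a) <-> forall v, qlab v a;
  qstep_serial : forall w, exists v, qstep w v;
  qstep_confluent : forall w w' v, qle w w' -> qstep w v ->
    exists2 v', qstep w' v' & qle v v';
  qsensible : forall w a, Dia a \in S -> qlab w (Dia a) ->
    exists n v, walk qstep n w v /\ qlab v a }.

(** * Prime theories over a logic *)

Section Worlds.

Variable L : fml -> Prop.
Hypothesis hL : logic L.

Definition world (G : fml -> Prop) : Prop := prime_theory G /\ subth L G.

Lemma world_theory G : world G -> theory G. Proof. by case=> [[]]. Qed.

(** If [G] omits [Imp a b], then [adjoin G a] omits [b], and Lindenbaum extends it to a prime theory
    that still does. *)
Lemma world_imp G a b : world G ->
  (G (Imp a b) <-> forall G', world G' -> subth G G' -> G' a -> G' b).
Proof.
move=> wG; have cG := world_theory wG; split=> [h G' wG' sG|h].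
  exact: (cl_mp (world_theory wG') (sG _ h)).
apply: contrapT => nab.
have [G' [pG' sG' nb]] := Lindenbaum (theory_adjoin cG a) nab.
have sGG : subth G G' by move=> p hp; apply: sG'; apply: sub_adjoin.
apply: nb; apply: h => //; last by apply: sG'; apply: mem_adjoin.
by split=> // p /wG.2/sGG.
Qed.

Lemma logic_complete p : (forall G, world G -> G p) -> L p.
Proof.
move=> h; apply: contrapT => np.
by have [G [pG sG]] := Lindenbaum (logic_theory hL) np; apply; apply: h.
Qed.

Lemma world_all G a : world G -> (G (All a) <-> L a).
Proof.
move=> wG; split=> [h|/(logic_all hL)/wG.2//]; apply: contrapT => na.
case: wG => -[cG nB _] sG; apply: nB; apply: cl_mp h => //.
exact/sG/(logic_nall hL).
Qed.

Definition next_world (G : fml -> Prop) : fml -> Prop := fun p => G (Next p).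

Lemma world_next G : world G -> world (next_world G).
Proof.
move=> [[cG nB pG] sG]; split; last by move=> p /(logic_next hL)/sG.
split.
- split=> [p hp|p q]; first exact/(cl_ax cG)/r_NecNext.
  exact: cl_ax2 (ax_N4 _ _).
- by move=> h; apply/nB/(cl_ax1 cG ax_N1 h).
- by move=> a b /(cl_ax1 cG (ax_N3 _ _))/pG.
Qed.

Lemma world_dia G a : world G -> (G (Dia a) <-> G a \/ G (Next (Dia a))).
Proof.
move=> wG; rewrite -(prime_or _ _ wG.1); have cG := world_theory wG.
have cL := logic_theory hL.
split=> [h|]; last exact: cl_ax1 (ax_E1 _).
(* [E1] under [Next] turns [Next t] into the second disjunct of [t], so the induction rule applies
   to [t]. *)
set t := Or _ _; have tt : ITL0 (Imp (Next t) t).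
  apply: cl_imp_trans (ax_orI2 _ _); first exact: theory_ITL0.
  by apply: r_MP (ax_N4 _ _) _; apply/r_NecNext/ax_E1.
apply: (cl_ax1 cG (r_Ind tt)); apply: cl_ax1 h => //.
exact/r_DiaMono/ax_orI1.
Qed.

Definition realizes (G : fml -> Prop) (w : seq fml * seq fml) : Prop :=
  (forall a, a \in w.1 -> G a) /\ (forall a, a \in w.2 -> ~ G a).

Definition chi (w : seq fml * seq fml) : fml := Imp (bigAnd w.1) (bigOr w.2).

Lemma chiP G w : world G ->
  (~ G (chi w) <-> exists G', [/\ world G', subth G G' & realizes G' w]).
Proof.
move=> wG; rewrite (world_imp _ _ wG); split.
  move=> /existsNP[G' /not_implyP[wG' /not_implyP[sG /not_implyP[h1 h2]]]].
  exists G'; split=> //; split=> [|a aw ha].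
    by apply/cl_bigAnd => //; apply: world_theory.
  by apply/h2/(prime_bigOr _ wG'.1); exists a.
move=> [G' [wG' sG [h1 h2]]] h.
have /(prime_bigOr _ wG'.1)[a /h2//] : G' (bigOr w.2).
by apply: h => //; apply/cl_bigAnd => //; apply: world_theory.
Qed.

Section Types.

Variable Sg : seq fml.
Hypothesis cSg : subformula_closed Sg.

(** Arranged so that [chi] of a point of rank [d], whose omitted formulas come from [level d], is
    available in [level d.+1]. *)
Fixpoint level (d : nat) : seq fml :=
  if d is d'.+1 then
    level d' ++ [seq chi (A, B) | A <- sublists Sg, B <- sublists (level d')]
  else Sg.

Lemma sub_level m n : m <= n -> {subset level m <= level n}.
Proof.
elim: n => [|n IH]; first by rewrite leqn0 => /eqP->.
rewrite leq_eqVlt => /predU1P[->//|]; rewrite ltnS => /IH h p /h {}h /=.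
by rewrite mem_cat h.
Qed.

Definition rank (G : fml -> Prop) : nat := count (fun a => ~~ `[< G a >]) Sg.

(* A point describes a theory by its trace on [Sg] and the formulas of [level]
   it omits.  The level decreases with every proper growth of the trace: this
   is what keeps the set of points finite while [chi] of a point above is still
   available among the omitted formulas. *)
Definition point (G : fml -> Prop) : seq fml * seq fml :=
  ([seq a <- Sg | `[< G a >]], [seq a <- level (rank G) | ~~ `[< G a >]]).

Lemma realizes_point G : realizes G (point G).
Proof.
by split=> a; rewrite mem_filter => /andP[/asboolP].
Qed.

Lemma realizes_label G H a : realizes H (point G) -> a \in Sg -> H a <-> G a.
Proof.
move=> [h1 h2] aS; split=> h; last first.
  by apply: h1; rewrite mem_filter aS andbT; apply/asboolP.
apply: contrapT => nG; case: (h2 a) => //.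
rewrite mem_filter (sub_level (leq0n _)) // andbT.
by apply/asboolP.
Qed.

Lemma mem_point G a : a \in Sg -> a \in (point G).1 <-> G a.
Proof.
move=> aS; rewrite mem_filter aS andbT; split=> /asboolP //.
Qed.

Lemma chi_point_level G : chi (point G) \in level (rank G).+1.
Proof.
rewrite /= mem_cat; apply/orP; right.
by apply/allpairsP; exists (point G); split; rewrite ?filter_sublists.
Qed.

(** If the ranks agree, so do the traces, and [G'] omits no more than [G]: then [H] itself serves.
    If the rank drops, [chi (point G')] is low enough to be among the formulas omitted by [G], hence
    by [H], and [chiP] yields the extension. *)
Lemma point_mono G G' H : world G -> world G' -> subth G G' -> world H ->
  realizes H (point G) ->
  exists H', [/\ world H', subth H H' & realizes H' (point G')].
Proof.
move=> wG wG' sG wH rH.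
have le a : ~~ `[< G' a >] -> ~~ `[< G a >].
  by apply: contra => /asboolP/sG h; apply/asboolP.
have := sub_count le Sg; rewrite -/(rank G) -/(rank G') leq_eqVlt => /predU1P[e|lt].
  have e1 : {in Sg, forall a, `[< G' a >] = `[< G a >]}.
    have : all (fun a => `[< G' a >] == `[< G a >]) Sg.
      move: e; rewrite /rank; elim: (Sg) => //= a s IH.
      move: (le a) (sub_count le s).
      case: `[< G' a >]; case: `[< G a >] => //= h l.
      - by rewrite add0n add1n => e; move: l; rewrite e ltnn.
      - by have := h isT.
      - by rewrite !add1n => -[/IH].
    by move/allP => h a /h/eqP.
  exists H; split=> //; split=> a.
    by rewrite mem_filter => /andP[ga aS]; apply: rH.1; rewrite mem_filter aS -e1 ?ga.
  by rewrite mem_filter e => /andP[/le ga al]; apply: rH.2; rewrite mem_filter ga.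
apply/chiP => //; apply: rH.2; rewrite mem_filter.
rewrite (sub_level lt) ?chi_point_level // andbT.
apply/asboolP => h; have := sG _ h; apply/chiP => //.
by exists G'; split=> //; apply: realizes_point.
Qed.

Definition is_point (w : seq fml * seq fml) : bool :=
  `[< exists2 G, world G & w = point G >].

Definition pt : Type := {w : seq fml * seq fml | is_point w}.

Lemma ptP (w : pt) : exists2 G, world G & sval w = point G.
Proof. by case: w => w /= /asboolP. Qed.

Lemma mk_pt G : world G -> exists w : pt, sval w = point G.
Proof.
move=> wG; have h : is_point (point G) by apply/asboolP; exists G.
by exists (exist _ (point G) h).
Qed.

(** All theories matching [w] are considered, not just one: transitivity and confluence apply the
    relation to a witness that is not of their choosing. *)
Definition pt_le (w v : pt) : Prop := forall H, world H -> realizes H (sval w) ->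
  exists H', [/\ world H', subth H H' & realizes H' (sval v)].

Definition pt_step (w v : pt) : Prop :=
  exists H, [/\ world H, realizes H (sval w) & sval v = point (next_world H)].

Definition label (w : pt) (a : fml) : Prop := a \in (sval w).1.

Lemma labelP (w : pt) G a : realizes G (sval w) -> a \in Sg -> label w a <-> G a.
Proof.
have [H wH e] := ptP w; rewrite /label e => rG aS.
by rewrite (mem_point _ aS) (realizes_label rG aS).
Qed.

Lemma pt_realized (w : pt) : exists2 G, world G & realizes G (sval w).
Proof.
by have [G wG e] := ptP w; exists G => //; rewrite e; apply: realizes_point.
Qed.

Lemma pt_sensible w a : Dia a \in Sg -> label w (Dia a) ->
  exists n v, walk pt_step n w v /\ label v a.
Proof.
move=> dS hw; have aS := cSg dS; apply: contrapT => none.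
pose R f := exists (v : pt) n, walk pt_step n w v /\ f = chi (sval v).
(* Ranks are at most [size Sg], so this level contains every [chi] of a point and [th] is a finite
   conjunction. *)
pose th := bigAnd [seq f <- level (size Sg).+1 | `[< R f >]].
have thP G : world G ->
    (G th <-> forall v n, walk pt_step n w v -> G (chi (sval v))).
  move=> wG; rewrite (cl_bigAnd _ (world_theory wG)); split=> [h v n r|h f].
    apply: h; rewrite mem_filter; apply/andP; split; first by apply/asboolP; exists v, n.
    have [H wH ->] := ptP v; apply: sub_level (chi_point_level H).
    by rewrite ltnS count_size.
  by rewrite mem_filter => /andP[/asboolP[v [n [r ->]]] _]; apply: h r.
(* If [H] has [Next th] but omits [chi v], some extension [H'] matches [v]. The point [u] of the
   successor of [H'] is reachable, so that successor has [chi u], although it matches [u] itself. *)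
have key : L (Imp (Next th) th).
  apply: logic_complete => G wG; apply/(world_imp _ _ wG) => H wH sH hth.
  apply/(thP _ wH) => v n r; apply: contrapT => /(chiP _ wH)[H' [wH' sH' rv]].
  have wN := world_next wH'.
  have [u eu] := mk_pt wN.
  have hN : next_world H' th by apply: sH'.
  have : next_world H' (chi (sval u)).
    by apply: ((thP _ wN).1 hN u n.+1); exists v => //; exists H'.
  by apply/(chiP _ wN); exists (next_world H'); split=> //; rewrite eu; apply: realizes_point.
have ath : L (Imp a th).
  apply: logic_complete => G wG; apply/(world_imp _ _ wG) => H wH sH ha.
  apply/(thP _ wH) => v n r; apply: contrapT => /(chiP _ wH)[H' [wH' sH' rv]].
  by apply: none; exists n, v; split=> //; apply/(labelP rv aS)/sH'.
have [G wG rG] := pt_realized w.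
have hth : G th.
  apply: (cl_mp (world_theory wG) (p := Dia a)); last exact/(labelP rG).
  by apply/wG.2/(cl_imp_trans (logic_theory hL) (logic_dia hL ath) (logic_ind hL key)).
by move/(thP _ wG)/(_ w 0 erefl): hth; apply/(chiP _ wG); exists G; split.
Qed.

Lemma pt_le_point G G' w v : world G -> world G' -> subth G G' ->
  sval w = point G -> sval v = point G' -> pt_le w v.
Proof. by move=> wG wG' sG ew ev H wH; rewrite ew ev; apply: point_mono. Qed.

Lemma label_mono w v a : a \in Sg -> pt_le w v -> label w a -> label v a.
Proof.
move=> aS le; have [G wG rG] := pt_realized w; have [H [wH sH rH]] := le G wG rG.
by move=> /(labelP rG aS)/sH/(labelP rH aS).
Qed.

Lemma pt_avoid a : a \in Sg -> ~ L a -> exists w, ~ label w a.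
Proof.
move=> aS na; apply: contrapT => h; apply: na; apply: logic_complete => G wG.
have [w ew] := mk_pt wG; apply: contrapT => nG; apply: h; exists w.
by rewrite /label ew => /(mem_point _ aS).
Qed.

Lemma logic_quasimodel : exists Q : quasimodel Sg,
  forall a, a \in Sg -> ~ L a -> exists w : qpt Q, ~ qlab w a.
Proof.
have le_refl w : pt_le w w by move=> H wH rH; exists H; split.
have le_trans w v u : pt_le w v -> pt_le v u -> pt_le w u.
  move=> h1 h2 H wH /(h1 H wH)[H1 [wH1 s1 /(h2 H1 wH1)[H2 [wH2 s2 r2]]]].
  by exists H2; split=> // p /s1/s2.
have lab_bot w : Bot \in Sg -> ~ label w Bot.
  have [G [[_ nB _] _] rG] := pt_realized w.
  by move=> bS /(labelP rG bS).
have lab_and w a b : And a b \in Sg -> label w (And a b) <-> label w a /\ label w b.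
  move=> iS; have [aS bS] := cSg iS; have [G wG rG] := pt_realized w.
  rewrite !(labelP rG) //; exact: cl_and (world_theory wG) _ _.
have lab_or w a b : Or a b \in Sg -> label w (Or a b) <-> label w a \/ label w b.
  move=> iS; have [aS bS] := cSg iS; have [G wG rG] := pt_realized w.
  rewrite !(labelP rG) //; exact: prime_or wG.1.
have lab_imp w a b : Imp a b \in Sg ->
    label w (Imp a b) <-> forall v, pt_le w v -> label v a -> label v b.
  move=> iS; have [aS bS] := cSg iS; split=> [h v wv|h].
    have := label_mono iS wv h; have [G wG rG] := pt_realized v.
    rewrite !(labelP rG) //; exact: cl_mp (world_theory wG) _ _.
  have [G wG eG] := ptP w; have rG : realizes G (sval w).
    by rewrite eG; apply: realizes_point.
  apply/(labelP rG iS)/(world_imp _ _ wG) => G' wG' sG ha.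
  have [v ev] := mk_pt wG'; have rv : realizes G' (sval v).
    by rewrite ev; apply: realizes_point.
  by apply/(labelP rv bS)/h; [apply: pt_le_point eG ev|apply/(labelP rv aS)].
have lab_next w v a : Next a \in Sg -> pt_step w v -> label w (Next a) <-> label v a.
  move=> nS [G [wG rG ev]]; by rewrite (labelP rG nS) /label ev (mem_point (next_world G) (cSg nS)).
have lab_dia w v a : Dia a \in Sg -> pt_step w v ->
    label w (Dia a) <-> label w a \/ label v (Dia a).
  move=> dS [G [wG rG ev]]; have aS := cSg dS.
  rewrite (labelP rG dS) (labelP rG aS) /label ev (mem_point (next_world G) dS).
  exact: world_dia.
have lab_all w a : All a \in Sg -> label w (All a) <-> forall v, label v a.
  move=> iS; have aS := cSg iS; have [G wG rG] := pt_realized w.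
  rewrite (labelP rG iS) (world_all _ wG); split=> [La v|h].
    by have [H wH rH] := pt_realized v; apply/(labelP rH aS)/wH.2.
  by apply: contrapT => /(pt_avoid aS)[v]; apply.
have serial w : exists v, pt_step w v.
  have [G wG rG] := pt_realized w.
  by have [v ev] := mk_pt (world_next wG); exists v, G.
have confluent w w' v : pt_le w w' -> pt_step w v ->
    exists2 v', pt_step w' v' & pt_le v v'.
  move=> le [G [wG rG ev]]; have [H [wH sH rH]] := le G wG rG.
  have [v' ev'] := mk_pt (world_next wH); exists v'; first by exists H.
  by apply: pt_le_point ev ev'; [apply: world_next..|move=> p /sH].
exists (Quasimodel le_refl le_trans label_mono lab_bot lab_and lab_or lab_imp
  lab_next lab_dia lab_all serial confluent pt_sensible).
exact: pt_avoid.
Qed.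

End Types.
End Worlds.

(** * Fair paths *)

Section Paths.

Variables (S : seq fml) (Q : quasimodel S).
Hypothesis cS : subformula_closed S.
Implicit Types (w v : qpt Q) (a : fml) (k : nat).

Definition dist_le w a (n : nat) : Prop :=
  exists m v, [/\ m <= n, walk (@qstep _ Q) m w v & qlab v a].

(** One successor serves all bounds [n]: the first vertex of a shortest walk to [a]. If [a] is
    unreachable or already holds, the condition is vacuous and any successor will do. *)
Lemma closer_step w a : exists v, qstep w v /\
  forall n, ~ qlab w a -> dist_le w a n.+1 -> dist_le v a n.
Proof.
case: (pselect (exists n, dist_le w a n)) => [h|no]; last first.
  have [v wv] := qstep_serial w; exists v; split=> // n _ d.
  by case: no; exists n.+1.
have h' : exists n, `[< dist_le w a n >] by case: h => n d; exists n; apply/asboolP.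
have [m /asboolP[m' [u [le wk lu]]] min] := ex_minnP h'.
case: m' le wk => [|m'] le wk.
  have [v wv] := qstep_serial w; exists v; split=> // n nw.
  by rewrite wk in nw.
have [v wv vu] := walkSl wk; exists v; split=> // n _ d.
exists m', u; split=> //; rewrite -ltnS; apply: leq_trans le _.
by apply: min; apply/asboolP.
Qed.

Definition closer w a : qpt Q := projT1 (cid (closer_step w a)).

Lemma closer_qstep w a : qstep w (closer w a).
Proof. by rewrite /closer; case: cid => v []. Qed.

Lemma closer_dist w a n :
  ~ qlab w a -> dist_le w a n.+1 -> dist_le (closer w a) a n.
Proof. by rewrite /closer; case: cid => v /= [_]; apply. Qed.

Definition focus k : fml := nth Bot S (k %% size S).

Definition pending w a : Prop := [/\ Dia a \in S, qlab w (Dia a) & ~ qlab w a].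

(* The scheduler follows a shortest path to the eventuality in focus, and moves
   the focus cyclically through [S] once nothing is pending. *)
Definition sched (s : qpt Q * nat) : qpt Q * nat :=
  (closer s.1 (focus s.2), if `[< pending s.1 (focus s.2) >] then s.2 else s.2.+1).

Lemma pending_dist w a : pending w a -> exists n, dist_le w a n.
Proof.
by case=> dS h _; have [n [v [wk lv]]] := qsensible dS h; exists n, n, v.
Qed.

Lemma dist_le0 w a : dist_le w a 0 -> qlab w a.
Proof. by case=> m [v [+ + lv]]; rewrite leqn0 => /eqP-> /= ->. Qed.

Lemma pending_persists w v a : pending w a -> qstep w v -> qlab v (Dia a).
Proof. by move=> [dS h na] st; case/(qlab_dia dS st): h. Qed.

(** The counter rests while its focus is pending, and each step lowers the bound on the distance, on
    which the induction runs. *)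
Lemma sched_resolves w k : pending w (focus k) ->
  exists j, qlab (iter j sched (w, k)).1 (focus k) /\ (iter j sched (w, k)).2 = k.
Proof.
move=> p; have [n d] := pending_dist p.
elim: n w p d => [|n IH] w p d; first by case: p => _ _ []; apply: dist_le0.
have [dS h na] := p.
pose u := closer w (focus k).
have es : sched (w, k) = (u, k) by rewrite /sched /=; case: asboolP.
have wu : qstep w u := closer_qstep w _.
case: (pselect (qlab u (focus k))) => [lu|nu]; first by exists 1; rewrite iterSr es.
have pu : pending u (focus k) by split=> //; apply: pending_persists p wu.
have [j hj] := IH u pu (closer_dist na d).
by exists j.+1; rewrite iterSr es.
Qed.

Lemma sched_advance w k : exists j, (iter j sched (w, k)).2 = k.+1.
Proof.
suff adv u : ~ pending u (focus k) -> (sched (u, k)).2 = k.+1.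
  case: (pselect (pending w (focus k))) => [p|np]; last by exists 1; apply: adv.
  have [j [lj ej]] := sched_resolves p; exists j.+1 => /=.
  by move: lj ej; case: (iter j sched _) => u k' /= lj ->; apply: adv; case.
by move=> np; rewrite /sched /=; case: asboolP.
Qed.

Lemma sched_reach w k d : exists j, (iter j sched (w, k)).2 = k + d.
Proof.
elim: d => [|d [j ej]]; first by exists 0; rewrite addn0.
move: ej; case e: (iter j sched _) => [u k'] /= ek.
have [i ei] := sched_advance u k'; exists (i + j).
by rewrite iterD e ei ek addnS.
Qed.

Lemma sched_sensible s a : Dia a \in S -> qlab s.1 (Dia a) ->
  exists j, qlab (iter j sched s).1 a.
Proof.
case: s => w k dS h; apply: contrapT => none.
have na j : ~ qlab (iter j sched (w, k)).1 a by move=> ?; apply: none; exists j.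
have pd j : pending (iter j sched (w, k)).1 a.
  elim: j => [|j IH]; first by split=> //; apply: (na 0).
  split; [by []| |exact: (na j.+1)].
  exact: pending_persists IH (closer_qstep _ _).
have aS : a \in S := cS dS.
have sz : 0 < size S by case: (S) aS.
(* Added to [k], this offset gives [k * size S + index a S], whose residue puts the focus on [a]. *)
have [j ej] := sched_reach w k (k * (size S).-1 + index a S).
have ef : focus (iter j sched (w, k)).2 = a.
  rewrite ej /focus addnA -mulnS prednK // modnMDl modn_small ?index_mem //.
  by rewrite nth_index.
move: ef (pd j) (na) ; case e: (iter j sched _) => [u k'] /= ef.
rewrite -ef => /sched_resolves[i [li _]] /(_ (i + j)); apply.
by rewrite iterD e.
Qed.

(* Eventually scheduled paths: a finite prefix followed by the scheduler.
   There are countably many of them. *)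
Definition qpath : Type := (seq (qpt Q) * (qpt Q * nat))%type.

Definition phead (p : qpath) : qpt Q := if p.1 is w :: _ then w else p.2.1.

Definition ptail (p : qpath) : qpath :=
  if p.1 is _ :: u then (u, p.2) else ([::], sched p.2).

Definition pnth (p : qpath) (i : nat) : qpt Q := phead (iter i ptail p).

Definition good (p : qpath) : Prop :=
  (forall i, qstep (pnth p i) (pnth p i.+1)) /\
  (forall i a, Dia a \in S -> qlab (pnth p i) (Dia a) ->
    exists j, qlab (pnth p (i + j)) a).

Lemma pnth_ptail p i : pnth (ptail p) i = pnth p i.+1.
Proof. by rewrite /pnth iterSr. Qed.

Lemma good_ptail p : good p -> good (ptail p).
Proof.
case=> h1 h2; split=> [i|i a dS]; rewrite !pnth_ptail; first exact: h1.
by move=> /(h2 _ _ dS)[j hj]; exists j; rewrite pnth_ptail.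
Qed.

Lemma good_sched s : good ([::], s).
Proof.
have e i : iter i ptail ([::], s) = ([::], iter i sched s).
  by elim: i => //= i ->.
split=> [i|i a dS]; rewrite /pnth !e /=; first exact: closer_qstep.
move=> /(sched_sensible dS)[j hj]; exists j.
by rewrite addnC /pnth e iterD.
Qed.

Lemma good_cons w p : qstep w (phead p) -> good p -> good (w :: p.1, p.2).
Proof.
move=> st [h1 h2]; set q := (_, _).
have eq i : pnth q i.+1 = pnth p i.
  by rewrite -pnth_ptail; congr pnth; rewrite /q; case: (p).
split=> [[|i]|[|i] a dS].
- by rewrite eq.
- by rewrite !eq.
- move=> /(qlab_dia dS st)[h|]; first by exists 0.
  by move=> /(h2 0 a dS)[j hj]; exists j.+1; rewrite add0n eq.
- by rewrite eq => /(h2 i a dS)[j hj]; exists j; rewrite addSn eq.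
Qed.

(** Confluence lifts the path for [t] positions. Then the scheduler takes over; it fulfils the
    eventualities but need not stay above [p], whence the bound on [i]. *)
Lemma good_above t p v : good p -> qle (phead p) v ->
  exists p', [/\ good p', phead p' = v &
    forall i, i < t -> qle (pnth p i) (pnth p' i)].
Proof.
elim: t p v => [|t IH] p v gp le.
  by exists ([::], (v, 0)); split=> //; apply: good_sched.
have [v' vv' le'] := qstep_confluent le (gp.1 0).
have [p' [gp' hp' lp']] := IH (ptail p) v' (good_ptail gp) le'.
exists (v :: p'.1, p'.2); split=> //; first by apply: good_cons => //; rewrite hp'.
case=> [|i] // it; rewrite -pnth_ptail; have := lp' i it.
by rewrite /pnth iterSr /ptail /=; case: (p').
Qed.

Lemma good_dia p a : good p -> Dia a \in S ->
  qlab (phead p) (Dia a) <-> exists n, qlab (pnth p n) a.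
Proof.
move=> gp dS; split=> [/(gp.2 0 a dS)[n hn]|[n]]; first by exists n.
elim: n p gp => [|n IH] p gp h; apply/(qlab_dia dS (gp.1 0)); first by left.
by right; apply: (IH (ptail p)); [apply: good_ptail|rewrite pnth_ptail].
Qed.

End Paths.

(** * Sequences of instructions *)

Section Runs.

Variables (S : seq fml) (Q : quasimodel S).
Hypothesis cS : subformula_closed S.
Variable p0 : qpath Q.
Hypothesis gp0 : good p0.
Implicit Types (x y : {poly int}) (p : qpath Q).
Local Open Scope ring_scope.

(** Zero must decode to no instruction, so that a run is constant beyond the support of its
    sequence. *)
Definition decode (z : int) : option (qpath Q) :=
  if z is Posz n.+1 then unpickle n else None.

Definition encode p : int := Posz (pickle p).+1.

Arguments encode : simpl never.

Lemma encodeK p : decode (encode p) = Some p.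
Proof. exact: pickleK. Qed.

Definition can_jump (t : nat) p p' : Prop :=
  good p' /\ forall i, (i < t)%N -> qle (pnth p i) (pnth p' i).

(* The coefficients of [x] are instructions: the one at [t] may replace the
   current path by another one that dominates it before time [t]. *)
Fixpoint run x (t : nat) : qpath Q :=
  if t is t'.+1 then
    if decode x`_t' is Some p' then
      if `[< can_jump t' (run x t') p' >] then p' else run x t'
    else run x t'
  else p0.

Lemma runS x t : run x t.+1 =
  if decode x`_t is Some p' then
    if `[< can_jump t (run x t) p' >] then p' else run x t
  else run x t.
Proof. by []. Qed.

Definition limit x : qpath Q := run x (size x).

Lemma run_good x t : good (run x t).
Proof.
elim: t => //= t IH; case: decode => // p'.
by case: asboolP => // -[].
Qed.

Lemma run_agree x y t : (forall s, (s < t)%N -> x`_s = y`_s) -> run x t = run y t.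
Proof.
elim: t => //= t IH h; rewrite h // IH // => s st; apply: h.
exact: ltnW.
Qed.

Lemma run_mono x m n i : (i < m)%N -> (m <= n)%N ->
  qle (pnth (run x m) i) (pnth (run x n) i).
Proof.
move=> im; elim: n => [|n IH]; first by rewrite leqn0 => /eqP->; apply: qle_refl.
rewrite leq_eqVlt => /predU1P[->|]; first exact: qle_refl.
rewrite ltnS => mn; apply: qle_trans (IH mn) _ => /=.
case: decode => [p'|]; last exact: qle_refl.
case: asboolP => [[_ h]|_]; last exact: qle_refl.
by apply: h; apply: leq_trans im mn.
Qed.

Lemma run_limit x t : (size x <= t)%N -> run x t = limit x.
Proof.
elim: t => [|t IH]; rewrite /limit; first by rewrite leqn0 => /eqP->.
rewrite leq_eqVlt => /predU1P[->//|]; rewrite ltnS => h /=.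
by rewrite nth_default //= IH.
Qed.

Lemma limit_good x : good (limit x).
Proof. exact: run_good. Qed.

Lemma limit_agree x y : (forall s, (s <= size x)%N -> x`_s = y`_s) ->
  qle (phead (limit x)) (phead (limit y)).
Proof.
(* The successor matters when [x] is 0: an instruction at time 0 may change even the head, so the
   agreement has to cover it. *)
move=> h; have e : run y (size x).+1 = limit x.
  by rewrite -(run_limit (leqnSn _)); apply: run_agree => s; rewrite ltnS => /h.
rewrite -(run_limit (leq_maxr (size x).+1 (size y))) -e.
exact: (run_mono _ (ltn0Sn _) (leq_maxl _ _)).
Qed.

(** A single instruction placed at [t], where the run of [x] has already reached its limit,
    redirects it to a path from [good_above]. *)
Lemma limit_jump x t v : (size x <= t)%N -> qle (phead (limit x)) v ->
  exists y, (forall s, (s < t)%N -> y`_s = x`_s) /\ phead (limit y) = v.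
Proof.
move=> xt le; have [p [gp <- lp]] := good_above cS t (limit_good x) le.
pose y := x + (encode p)%:P * 'X^t.
have ey s : y`_s = if s == t then encode p else x`_s.
  rewrite coefD coefCM coefXn; case: eqVneq => [->|_]; last by rewrite mulr0 addr0.
  by rewrite nth_default // mulr1 add0r.
exists y; split=> [s st|]; first by rewrite ey ltn_eqF.
have st : run y t = limit x.
  by rewrite -(run_limit xt); apply: run_agree => s st; rewrite ey ltn_eqF.
have sy : (size y <= t.+1)%N.
  apply/leq_sizeP => s ts; rewrite ey gtn_eqF // nth_default //.
  by apply: leq_trans xt (ltnW ts).
rewrite -(run_limit sy) /= ey eqxx encodeK st.
by case: asboolP => // -[].
Qed.

Lemma limit_surj w : exists x, phead (limit x) = w.
Proof.
have gw : good ([::] : seq (qpt Q), (w, 0%N)) := good_sched cS _.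
exists (encode ([::], (w, 0%N)))%:P.
rewrite -(run_limit (size_polyC_leq1 _)) /= coefC eqxx encodeK.
by case: asboolP => // -[].
Qed.

(* Time moves forward by one: the path is replaced by its tail, and so is the
   target of every instruction, which now comes one step earlier. *)
Definition shift x : {poly int} :=
  \poly_(t < (size x).+1)
    (if (t == 0%N) || decode x`_t.+1 then encode (ptail (run x t.+2)) else 0).

Lemma coef_shift x t : (shift x)`_t =
  if (t == 0%N) || decode x`_t.+1 then encode (ptail (run x t.+2)) else 0.
Proof.
rewrite coef_poly ltnS; case: leqP => // h.
by rewrite (gtn_eqF (leq_ltn_trans (leq0n _) h)) nth_default // ltnW // ltnW.
Qed.

(** Entry 0 of [shift x] absorbs entries 0 and 1 of [x], since a jump at time 0 is unrestricted.
    Later entries name the tail of the run actually reached, and [run_mono] makes these jumps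
    admissible. *)
Lemma run_shift x t : run (shift x) t.+1 = ptail (run x t.+2).
Proof.
elim: t => [|t IH].
  have e : (shift x)`_0 = encode (ptail (run x 2)) by rewrite coef_shift.
  rewrite [LHS]/= e encodeK; case: asboolP => // -[]; split=> //.
  exact: good_ptail (run_good x 2).
have e : (shift x)`_t.+1 =
    if decode x`_t.+2 then encode (ptail (run x t.+3)) else 0 by rewrite coef_shift.
rewrite runS e IH; case d : (decode x`_t.+2) => [p|]; last by rewrite [run x t.+3]runS d.
rewrite encodeK; case: asboolP => // -[]; split.
  exact: good_ptail (run_good x t.+3).
by move=> i it; rewrite !pnth_ptail; apply: run_mono.
Qed.

Lemma limit_shift x : limit (shift x) = ptail (limit x).
Proof.
pose t := maxn (size x) (size (shift x)).
have h1 : (size x <= t.+2)%N by do 2!apply: leqW; apply: leq_maxl.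
have h2 : (size (shift x) <= t.+1)%N by apply: leqW; apply: leq_maxr.
by rewrite -(run_limit h1) -(run_limit h2) run_shift.
Qed.

Lemma shift_agree x y t : (forall s, (s <= t.+1)%N -> x`_s = y`_s) ->
  forall s, (s <= t)%N -> (shift x)`_s = (shift y)`_s.
Proof.
move=> h s st; rewrite !coef_shift h ?ltnS // (@run_agree x y) // => r rs.
by apply: h; rewrite -ltnS; apply: leq_trans rs _; rewrite !ltnS.
Qed.

End Runs.

(** * Cantor's theorem on countable dense orders *)

Record dense_unbounded (T : Type) (lt : T -> T -> Prop) : Prop := DenseUnbounded {
  du_irr : forall x, ~ lt x x;
  du_trans : forall x y z, lt x y -> lt y z -> lt x z;
  du_total : forall x y, [\/ lt x y, x = y | lt y x];
  du_dense : forall x y, lt x y -> exists2 z, lt x z & lt z y;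
  du_left : forall x, exists y, lt y x;
  du_right : forall x, exists y, lt x y }.

Lemma du_upper (T : eqType) (lt : T -> T -> Prop) (s : seq T) (u : T) :
  dense_unbounded lt -> (forall x, x \in s -> lt x u) ->
  exists2 z, lt z u & forall x, x \in s -> lt x z.
Proof.
move=> D; elim: s => [|y s IH] h; first by have [z zu] := du_left D u; exists z.
have [|z zu hz] := IH; first by move=> x xs; apply: h; rewrite inE xs orbT.
have yu : lt y u by apply: h; rewrite mem_head.
have [z' h1 h2] : exists2 z', lt z' u & lt y z' /\ (z' = z \/ lt z z').
  case: (du_total D y z) => [yz|yz|zy]; first by exists z => //; split=> //; left.
  - have [z' h1 h2] := du_dense D zu; exists z' => //; split; last by right.
    by rewrite yz.
  - have [z' h1 h2] := du_dense D yu; exists z' => //; split=> //; right.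
    exact: (du_trans D zy h1).
exists z' => // x; rewrite in_cons => /predU1P[->|/hz xz]; first by case: h2.
by case: h2 => _ [->//|]; apply: (du_trans D xz).
Qed.

Lemma du_bound (T : eqType) (lt : T -> T -> Prop) (s : seq T) (d : T) :
  dense_unbounded lt -> exists z, forall x, x \in s -> lt x z.
Proof.
move=> D; elim: s => [|y s [z hz]]; first by exists d.
have [z' h] : exists z', lt y z' /\ (z' = z \/ lt z z').
  case: (du_total D y z) => [yz|yz|zy]; first by exists z; split=> //; left.
  - by have [z' h1] := du_right D z; exists z'; split; [rewrite yz|right].
  - have [z' h1] := du_right D y; exists z'; split=> //; right.
    exact: (du_trans D zy h1).
exists z' => x; rewrite in_cons => /predU1P[->|/hz xz]; first by case: h.
by case: h => _ [->//|]; apply: (du_trans D xz).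
Qed.

Lemma du_separate (T : eqType) (lt : T -> T -> Prop) (l u : seq T) (d : T) :
  dense_unbounded lt -> (forall x y, x \in l -> y \in u -> lt x y) ->
  exists z, (forall x, x \in l -> lt x z) /\ (forall y, y \in u -> lt z y).
Proof.
move=> D; elim: u => [|y u IH] h.
  by have [z hz] := du_bound l d D; exists z.
have [|z [hz zu]] := IH; first by move=> x y' xl yu; apply: h; rewrite // inE yu orbT.
have [|z' zy hz'] := du_upper D (s := l) (u := y).
  by move=> x xl; apply: h; rewrite ?mem_head.
case: (du_total D z z') => [zz|zz|zz].
- exists z; split=> // y'; rewrite in_cons => /predU1P[->|/zu//].
  exact: (du_trans D zz zy).
- by exists z; split=> // y'; rewrite in_cons => /predU1P[->|/zu//]; rewrite zz.
- exists z'; split=> // y'; rewrite in_cons => /predU1P[->//|/zu].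
  exact: (du_trans D zz).
Qed.

Section Cantor.

Variables (A B : countType) (ltA : A -> A -> Prop) (ltB : B -> B -> Prop).
Hypotheses (dA : dense_unbounded ltA) (dB : dense_unbounded ltB).

Definition partial_iso (s : seq (A * B)) : Prop :=
  forall p q, p \in s -> q \in s ->
    (ltA p.1 q.1 <-> ltB p.2 q.2) /\ (p.1 = q.1 <-> p.2 = q.2).

(** One half of back and forth: for a new [a], the images of the points below it precede those of
    the points above it, and [du_separate] finds [b] between them. *)
Lemma iso_extend s (b0 : B) a : partial_iso s ->
  exists b, partial_iso ((a, b) :: s).
Proof.
move=> ps; case: (pselect (exists2 p, p \in s & p.1 = a)) => [[p p_s <-]|new].
  exists p.2 => q r; rewrite -surjective_pairing !in_cons.
  by move=> /predU1P[->|qs] /predU1P[->|rs]; apply: ps.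
have nw p : p \in s -> p.1 <> a by move=> h e; apply: new; exists p.
pose l := [seq p.2 | p <- s & `[< ltA p.1 a >]].
pose u := [seq p.2 | p <- s & `[< ltA a p.1 >]].
have [] := @du_separate B ltB l u b0 dB.
  move=> x y /mapP[p]; rewrite mem_filter => /andP[/asboolP pa p_s] ->.
  move=> /mapP[q]; rewrite mem_filter => /andP[/asboolP aq q_s] ->.
  by apply/(ps p q p_s q_s).1; apply: (du_trans dA pa aq).
move=> b [lb bu]; exists b.
have key p : p \in s -> (ltA p.1 a /\ ltB p.2 b) \/ (ltA a p.1 /\ ltB b p.2).
  move=> h; case: (du_total dA p.1 a) => [pa|/(nw _ h)//|ap]; [left|right]; split=> //.
  - by apply: lb; apply: map_f; rewrite mem_filter h andbT; apply/asboolP.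
  - by apply: bu; apply: map_f; rewrite mem_filter h andbT; apply/asboolP.
have asA x y : ltA x y -> ~ ltA y x by move=> h /(du_trans dA h)/(du_irr dA).
have asB x y : ltB x y -> ~ ltB y x by move=> h /(du_trans dB h)/(du_irr dB).
have neA x y : ltA x y -> x <> y by move=> h e; move: h; rewrite e; apply: (du_irr dA).
have neB x y : ltB x y -> x <> y by move=> h e; move: h; rewrite e; apply: (du_irr dB).
move=> p q; rewrite !in_cons => /predU1P[->|p_s] /predU1P[->|q_s] /=; last exact: ps.
- by split; split=> // h; [case: (du_irr dA h)|case: (du_irr dB h)].
- have [[h1 h2]|[h1 h2]] := key q q_s; split; split=> //.
  + by move/(asA _ _ h1).
  + by move/(asB _ _ h2).
  + by move/esym/(neA _ _ h1).
  + by move/esym/(neB _ _ h2).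
  + by move/(neA _ _ h1).
  + by move/(neB _ _ h2).
- have [[h1 h2]|[h1 h2]] := key p p_s; split; split=> //.
  + by move/(neA _ _ h1).
  + by move/(neB _ _ h2).
  + by move/(asA _ _ h1).
  + by move/(asB _ _ h2).
  + by move/esym/(neA _ _ h1).
  + by move/esym/(neB _ _ h2).
Qed.

End Cantor.

Lemma partial_iso_sym (A B : countType) ltA ltB (s : seq (A * B)) :
  partial_iso ltA ltB s -> partial_iso ltB ltA [seq (p.2, p.1) | p <- s].
Proof.
move=> h p q /mapP[p' p's ->] /mapP[q' q's ->] /=.
by have [h1 h2] := h p' q' p's q's; split; apply: iff_sym.
Qed.

Lemma Cantor_iso (A B : countType) ltA ltB (a0 : A) (b0 : B) :
  dense_unbounded ltA -> dense_unbounded ltB ->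
  exists (h : A -> B) (k : B -> A),
    [/\ cancel h k, cancel k h & forall x y, ltA x y <-> ltB (h x) (h y)].
Proof.
move=> dA dB.
pose T := {s : seq (A * B) | partial_iso ltA ltB s}.
have forth (s : T) a : exists t : T, {subset sval s <= sval t} /\ exists b, (a, b) \in sval t.
  case: s => s /= hs; have [b hb] := iso_extend dA dB b0 a hs.
  exists (exist (partial_iso ltA ltB) _ hb); split=> /=; first by move=> x xs; rewrite inE xs orbT.
  by exists b; rewrite mem_head.
have back (s : T) b : exists t : T, {subset sval s <= sval t} /\ exists a, (a, b) \in sval t.
  case: s => s /= hs; have [a ha] := iso_extend dB dA a0 b (partial_iso_sym hs).
  have ha' : partial_iso ltA ltB ((a, b) :: s).
    have := partial_iso_sym ha; rewrite /= -map_comp.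
    by rewrite (_ : map _ s = s) // -[RHS]map_id; apply: eq_map; case.
  exists (exist (partial_iso ltA ltB) _ ha'); split=> /=; first by move=> x xs; rewrite inE xs orbT.
  by exists a; rewrite mem_head.
(* Stage [n] takes care of the elements with code [n] on both sides, so the union of the stages is
   total and onto. *)
have step n (s : T) : exists t : T, [/\ {subset sval s <= sval t},
    forall a, unpickle n = Some a -> exists b, (a, b) \in sval t &
    forall b, unpickle n = Some b -> exists a, (a, b) \in sval t].
  have [t [st ht]] : exists t : T, {subset sval s <= sval t} /\
      forall a, unpickle n = Some a -> exists b, (a, b) \in sval t.
    case: (unpickle n) => [a|]; last by exists s; split.
    by have [t [st hb]] := forth s a; exists t; split=> // a' [<-].
  have [t' [st' ht']] : exists t' : T, {subset sval t <= sval t'} /\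
      forall b, unpickle n = Some b -> exists a, (a, b) \in sval t'.
    case: (unpickle n) => [b|]; last by exists t; split.
    by have [t' [st' hb]] := back t b; exists t'; split=> // b' [<-].
  exists t'; split=> //; first by move=> x /st/st'.
  by move=> a /ht[b /st']; exists b.
have nil_iso : partial_iso ltA ltB [::] by [].
pose F := fix F n : T := if n is n'.+1 then projT1 (cid (step n' (F n')))
                         else exist (partial_iso ltA ltB) [::] nil_iso.
have FP n := projT2 (cid (step n (F n))); rewrite /= -/(F _.+1) in FP.
have Fmono m n : m <= n -> {subset sval (F m) <= sval (F n)}.
  elim: n => [|n IH]; first by rewrite leqn0 => /eqP->.
  rewrite leq_eqVlt => /predU1P[->//|]; rewrite ltnS => /IH h x /h.
  by have [h1 _ _] := FP n; apply: h1.
pose G p := exists n, p \in sval (F n).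
have Giso p q : G p -> G q -> (ltA p.1 q.1 <-> ltB p.2 q.2) /\ (p.1 = q.1 <-> p.2 = q.2).
  move=> [m hm] [n hn]; apply: (svalP (F (maxn m n))).
    exact: Fmono (leq_maxl _ _) _ hm.
  exact: Fmono (leq_maxr _ _) _ hn.
have Gf a : exists b, G (a, b).
  have [_ /(_ a (pickleK a))[b hb] _] := FP (pickle a).
  by exists b, (pickle a).+1.
have Gb b : exists a, G (a, b).
  have [_ _ /(_ b (pickleK b))[a ha]] := FP (pickle b).
  by exists a, (pickle b).+1.
pose h a := projT1 (cid (Gf a)); pose k b := projT1 (cid (Gb b)).
have hP a : G (a, h a) := projT2 (cid (Gf a)).
have kP b : G (k b, b) := projT2 (cid (Gb b)).
exists h, k; split.
- by move=> a; apply/(Giso _ _ (kP (h a)) (hP a)).2.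
- by move=> b; apply/(Giso _ _ (hP (k b)) (kP b)).2.
- by move=> x y; apply: (Giso _ _ (hP x) (hP y)).1.
Qed.

(** * The countermodel on the rationals *)

Section LexicographicOrder.

Local Open Scope ring_scope.
Implicit Types (x y z : {poly int}) (d : int) (s t : nat).

Definition plex x y : Prop :=
  exists t, (forall s, (s < t)%N -> x`_s = y`_s) /\ x`_t < y`_t.

Definition bump x t d : {poly int} := x + d%:P * 'X^t.

Lemma coef_bump x t d s : (bump x t d)`_s = if s == t then x`_t + d else x`_s.
Proof.
rewrite coefD coefCM coefXn; case: eqVneq => [->|_]; first by rewrite mulr1.
by rewrite mulr0 addr0.
Qed.

Lemma bump_agree x t d s : (s < t)%N -> (bump x t d)`_s = x`_s.
Proof. by move=> st; rewrite coef_bump ltn_eqF. Qed.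

Lemma plex_bump x t d : 0 < d -> plex x (bump x t d).
Proof.
move=> d0; exists t; split; first by move=> s st; rewrite bump_agree.
by rewrite coef_bump eqxx ltrDl.
Qed.

Lemma plex_bumpN x t d : d < 0 -> plex (bump x t d) x.
Proof.
move=> d0; exists t; split; first by move=> s st; rewrite bump_agree.
by rewrite coef_bump eqxx gtrDl.
Qed.

Lemma plex_dense_unbounded : dense_unbounded plex.
Proof.
split.
- by move=> x [t []]; rewrite ltxx.
- move=> x y z [t [h1 lt1]] [t' [h2 lt2]]; case: (ltngtP t t') => tt.
  + exists t; split; last by rewrite -h2.
    by move=> s st; rewrite h1 // h2 // (ltn_trans st).
  + exists t'; split; last by rewrite h1.
    by move=> s st; rewrite h1 ?h2 // (ltn_trans st).
  + exists t; split; last by apply: lt_trans lt1 _; rewrite tt.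
    by move=> s st; rewrite h1 // h2 // -tt.
- move=> x y; case: (eqVneq x y) => [->|ne]; first exact: Or32.
  have ex : exists t, x`_t != y`_t.
    apply: contrapT => h; case/eqP: ne; apply/polyP => t.
    by apply: contrapT => /eqP e; apply: h; exists t.
  have [t nt min] := ex_minnP ex.
  have ag s : (s < t)%N -> x`_s = y`_s.
    by rewrite ltnNge => st; apply: contrapT => /eqP/min; apply/negP.
  case: (ltgtP x`_t y`_t) => [h|h|e].
  + by apply: Or31; exists t.
  + by apply: Or33; exists t; split=> // s /ag.
  + by rewrite e eqxx in nt.
(* A change just after the first difference leaves the comparison with [y] intact. *)
- move=> x y [t [h lt]]; exists (bump x t.+1 1); first exact: plex_bump.
  exists t; split; last by rewrite bump_agree.
  by move=> s st; rewrite bump_agree ?h // ltnW.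
- by move=> x; exists (bump x 0 (-1)); apply: plex_bumpN.
- by move=> x; exists (bump x 0 1); apply: plex_bump.
Qed.

(** A first disagreement before [t] would break one of the two bounds. With [plex_interval], this
    identifies the order topology with that of initial segments. *)
Lemma plex_pinch x y t : plex (bump x t (-1)) y -> plex y (bump x t 1) ->
  forall s, (s < t)%N -> y`_s = x`_s.
Proof.
move=> [t1 [h1 lt1]] [t2 [h2 lt2]] s; elim/ltn_ind: s => s IH st.
apply/le_anti/andP; split.
- case: (ltngtP s t2) => [/h2|lt|e].
  + by rewrite bump_agree // => ->.
  + have tt := ltn_trans lt st.
    by move: lt2; rewrite bump_agree // IH // ltxx.
  + by move: lt2; rewrite -e bump_agree // => /ltW.
- case: (ltngtP s t1) => [/h1|lt|e].
  + by rewrite bump_agree // => ->.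
  + have tt := ltn_trans lt st.
    by move: lt1; rewrite bump_agree // IH // ltxx.
  + by move: lt1; rewrite -e bump_agree // => /ltW.
Qed.

Lemma plex_interval x y z : plex y x -> plex x z ->
  exists t, forall x', (forall s, (s < t)%N -> x'`_s = x`_s) -> plex y x' /\ plex x' z.
Proof.
move=> [t1 [h1 lt1]] [t2 [h2 lt2]]; exists (maxn t1 t2).+1 => x' h.
split; [exists t1|exists t2]; split.
- by move=> s st; rewrite h1 // h // ltnS leq_max ltnW.
- by rewrite h // ltnS leq_max leqnn.
- by move=> s st; rewrite h ?h2 // ltnS leq_max (ltnW st) orbT.
- by rewrite h // ltnS leq_max leqnn orbT.
Qed.

Lemma rat_dense_unbounded : dense_unbounded (fun x y : rat => x < y).
Proof.
split.
- by move=> x; rewrite ltxx.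
- by move=> x y z; apply: lt_trans.
- by move=> x y; case: (ltgtP x y) => h; [exact: Or31|exact: Or33|exact: Or32].
- by move=> x y /midf_lt[h1 h2]; exists ((x + y) / 2%:R).
- by move=> x; exists (x - 1); rewrite gtrBl.
- by move=> x; exists (x + 1); rewrite ltrDl.
Qed.

End LexicographicOrder.

(** * Transfer to the rationals and the truth lemma *)

Section Countermodel.

Local Open Scope ring_scope.
Variables (S : seq fml) (Q : quasimodel S).
Hypothesis cS : subformula_closed S.
Variable p0 : qpath Q.
Hypothesis gp0 : good p0.
Variables (h : rat -> {poly int}) (k : {poly int} -> rat).
Hypotheses (hK : cancel h k) (kK : cancel k h).
Hypothesis h_mono : forall x y : rat, x < y <-> plex (h x) (h y).

Lemma ball_agree q t : exists e : rat, 0 < e /\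
  forall q', `|q' - q| < e -> forall s, (s < t)%N -> (h q')`_s = (h q)`_s.
Proof.
pose l := k (bump (h q) t (-1)); pose r := k (bump (h q) t 1).
have lq : l < q by apply/h_mono; rewrite kK; apply: plex_bumpN.
have qr : q < r by apply/h_mono; rewrite kK; apply: plex_bump.
exists (Num.min (q - l) (r - q)); split; first by rewrite lt_min !subr_gt0 lq.
move=> q'; rewrite lt_min !ltr_norml => /andP[/andP[h1 _] /andP[_ h2]].
by apply: plex_pinch; rewrite -[bump _ _ _]kK; apply/h_mono; rewrite -/l -/r; lra.
Qed.

Lemma agree_ball q (e : rat) : 0 < e -> exists t, forall x : {poly int},
  (forall s, (s < t)%N -> x`_s = (h q)`_s) -> `|k x - q| < e.
Proof.
move=> e0.
have h1 : plex (h (q - e)) (h q) by apply/h_mono; lra.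
have h2 : plex (h q) (h (q + e)) by apply/h_mono; lra.
have [t ht] := plex_interval h1 h2; exists t => x /ht[].
by rewrite -[x]kK => /h_mono l /h_mono r; rewrite kK ltr_norml; apply/andP; split; lra.
Qed.

Let tau q : qpath Q := limit p0 (h q).

Definition flow (q : rat) : rat := k (shift p0 (h q)).

(** The guard [Var n \in S] secures openness, since labels are monotone only for formulas of [S]. *)
Definition valuation (n : nat) (q : rat) : Prop :=
  Var n \in S /\ qlab (phead (tau q)) (Var n).

Lemma flow_continuous : Qcontinuous flow.
Proof.
move=> U oU q /oU[e [e0 he]].
have [t ht] := agree_ball (flow q) e0.
have [e' [e'0 he']] := ball_agree q t.+2.
exists e'; split=> // q' /he' ag; apply/he/ht => s st.
rewrite kK; apply: (@shift_agree _ _ _ _ _ t) (ltnW st) => r rt.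
by apply: ag; rewrite ltnS.
Qed.

Lemma tau_flow q n : phead (tau (iter n flow q)) = pnth (tau q) n.
Proof.
rewrite /pnth; congr phead; elim: n => //= n IH.
by rewrite /tau /flow kK limit_shift // -/(tau _) IH.
Qed.

Lemma tau_good q : good (tau q). Proof. exact: limit_good. Qed.

Lemma tau_continuous q : exists e : rat, 0 < e /\
  forall q', `|q' - q| < e -> qle (phead (tau q)) (phead (tau q')).
Proof.
have [e [e0 he]] := ball_agree q (size (h q)).+1.
exists e; split=> // q' /he ag; apply: limit_agree => s st.
by rewrite ag // ltnS.
Qed.

Lemma tau_open q v (e : rat) : 0 < e -> qle (phead (tau q)) v ->
  exists q', `|q' - q| < e /\ phead (tau q') = v.
Proof.
move=> e0 le; have [t ht] := agree_ball q e0.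
have [y [ay ey]] := limit_jump cS gp0 (leq_maxr t (size (h q))) le.
exists (k y); split; last by rewrite /tau kK.
by apply: ht => s st; apply: ay; rewrite leq_max st.
Qed.

Lemma label_open a : a \in S -> Qopen (fun q => qlab (phead (tau q)) a).
Proof.
move=> aS q lq; have [e [e0 he]] := tau_continuous q.
by exists e; split=> // q' /he le; apply: qlab_mono le lq.
Qed.

Lemma sem_label a q : a \in S -> sem flow valuation a q <-> qlab (phead (tau q)) a.
Proof.
elim: a q => [|n|a IHa b IHb|a IHa b IHb|a IHa b IHb|a IHa|a IHa|a IHa] q aS /=.
- by split=> // /(qlab_bot aS).
- by split=> [[]|].
- by have [? ?] := cS aS; rewrite IHa // IHb // (qlab_and _ aS).
- by have [? ?] := cS aS; rewrite IHa // IHb // (qlab_or _ aS).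
- have [iS jS] := cS aS; split.
    (* By [tau_open] every point above the label of [q] is the label of some rational in [U], so the
       interior sees all of them. *)
    move=> [U [oU [Uq sU]]]; apply/(qlab_imp _ aS) => v le.
    have [e [e0 he]] := oU _ Uq; have [q' [/he/sU + <-]] := tau_open e0 le.
    by rewrite IHa // IHb // => -[].
  move=> l; exists (fun q => qlab (phead (tau q)) (Imp a b)).
  split; first exact: label_open.
  split=> // q' l'; rewrite IHa // IHb //.
  case: (pselect (qlab (phead (tau q')) a)) => ha; [right|by left].
  by apply: (qlab_imp _ aS).1 l' _ (qle_refl _) ha.
- rewrite IHa; last exact: cS aS.
  rewrite (qlab_next aS ((tau_good q).1 0)).
  by rewrite -(tau_flow q 1).
- rewrite (good_dia (tau_good q) aS).
  by split=> -[n hn]; exists n; move: hn; rewrite IHa ?tau_flow //; apply: cS aS.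
- rewrite (qlab_all _ aS); have iS := cS aS; split=> hy.
    move=> v; have [x <-] := limit_surj cS p0 v.
    by rewrite -[x]kK; apply/IHa.
  by move=> y; apply/IHa.
Qed.

Lemma tau_surj v : exists q, phead (tau q) = v.
Proof. by have [x <-] := limit_surj cS p0 v; exists (k x); rewrite /tau kK. Qed.

End Countermodel.

Lemma quasimodel_sound S (Q : quasimodel S) a (w : qpt Q) :
  subformula_closed S -> a \in S ->
  (forall f, Qcontinuous f -> valid_on_Q f a) -> qlab w a.
Proof.
move=> cS aS val.
have gp := good_sched cS (w, 0%N).
have [h [k [hK kK hm]]] := Cantor_iso 0%R 0%R rat_dense_unbounded plex_dense_unbounded.
have [q <-] := tau_surj cS ([::], (w, 0%N)) kK w.
apply/(sem_label cS gp kK hm) => //.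
apply: val; first exact: flow_continuous.
move=> n x [nS l]; have [e [e0 he]] := label_open kK hm nS l.
by exists e; split=> // y /he.
Qed.

Theorem theorem11p8 (phi : fml) :
  (forall f : rat -> rat, Qcontinuous f -> valid_on_Q f phi) -> ITL0 phi.
Proof.
move=> val; apply: contrapT => /(Lindenbaum theory_ITL0)[G [pG _ nphi]].
(* By [UA4], omitting [phi] puts it outside the logic of what [G] holds globally. *)
have nL : ~ G (All phi).
  by have [cG _ _] := pG => h; apply/nphi/(cl_ax1 cG (ax_UA4 _) h).
have [Q hQ] := logic_quasimodel (logic_of_prime pG) (@subformulas_closed phi).
have [w nw] := hQ _ (mem_subformulas phi) nL.
exact/nw/(quasimodel_sound _ (@subformulas_closed phi) (mem_subformulas phi) val).
Qed.
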